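(* Let $S=(s_1,s_2,\ldots)$ be a packing sequence with $s_1=1$, and let $n\ge 3$. (i) If $n\le s_2+2$, then $C_n$ is $\chi_S$-critical if and only if $n$ is odd. (ii) If $s_2+3\le n\le 2s_2+1$, then $C_n$ is $\chi_S$-critical.
   Context: All graphs are finite and simple; $C_n$ is the cycle on $n$ vertices. A packing sequence is an infinite non-decreasing sequence $S=(s_1,s_2,\ldots)$ of positive integers. A map $c:V(G)\to\{1,\ldots,m\}$ is an $S$-packing $m$-coloring if for distinct $u,v$, $c(u)=c(v)=i$ implies $d_G(u,v)>s_i$; $\chi_S(G)$ is the least such $m$. $G$ is $\chi_S$-critical if $\chi_S(H)<\chi_S(G)$ for every proper (nonempty) subgraph $H$ of $G$. *)

(* Defs.v *)
From mathcomp Require Import all_boot.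

Set Implicit Arguments.
Unset Strict Implicit.
Unset Printing Implicit Defensive.

(* Finite simple graphs whose vertices lie in an ambient finite type, so that
   a graph and its subgraphs (on fewer vertices) have the same type. *)
Record graph (T : finType) := Graph {
  verts : {set T};
  edges : {set {set T}};
  edgesP : [forall e in edges, (e \subset verts) && (#|e| == 2)]
}.

Section Graphs.

Variable T : finType.
Implicit Types (G H : graph T) (u v : T) (s : nat -> nat).

Definition adj G : rel T := fun u v => [set u; v] \in edges G.

Definition subgraph H G : bool :=
  (verts H \subset verts G) && (edges H \subset edges G).

Definition proper_subgraph H G : bool :=
  subgraph H G && ((verts H != verts G) || (edges H != edges G)).

Definition has_walk G u v (k : nat) : bool :=
  [exists p : k.-tuple T, path (adj G) u p && (last u p == v)].

Lemma connect_has_walk G u v :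
  connect (adj G) u v -> exists k, has_walk G u v k.
Proof.
case/connectP=> p pP ->; exists (size p); apply/existsP.
by exists (in_tuple p); rewrite /= pP eqxx.
Qed.

(* [None] stands for the infinite distance between different components. *)
Definition gdist G u v : option nat :=
  if @idP (connect (adj G) u v) is ReflectT uv
  then Some (ex_minn (connect_has_walk uv)) else None.

Definition gdist_gt G u v (k : nat) : bool :=
  if gdist G u v is Some d then k < d else true.

(* The colours 1, ..., m are the nonzero elements of ['I_m.+1]; the values of
   [c] outside [verts G] are irrelevant. *)
Definition packing_coloring s G (m : nat) (c : {ffun T -> 'I_m.+1}) : bool :=
  [forall v in verts G, 0 < c v] &&
  [forall u in verts G, forall v in verts G,
     (u != v) && (c u == c v) ==> gdist_gt G u v (s (c u))].

Definition packing_colorable s G (m : nat) : bool :=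
  [exists c : {ffun T -> 'I_m.+1}, packing_coloring s G c].

Lemma packing_colorable_ex s G : exists m, packing_colorable s G m.
Proof.
exists #|T|; apply/existsP; exists [ffun v => lift ord0 (enum_rank v)].
apply/andP; split; apply/forall_inP=> u _; first by rewrite ffunE.
apply/forall_inP=> v _; apply/implyP; rewrite !ffunE => /andP[uv].
by move/eqP/lift_inj/enum_rank_inj => eq_uv; rewrite eq_uv eqxx in uv.
Qed.

Definition chiS s G : nat := ex_minn (packing_colorable_ex s G).

Definition chiS_critical s G : Prop :=
  forall H, proper_subgraph H G -> verts H != set0 -> chiS s H < chiS s G.

End Graphs.

(* The sequence is s 1, s 2, ...; the value s 0 is never used. *)
Definition packing_sequence (s : nat -> nat) : Prop :=
  (forall i, 0 < i -> 0 < s i) /\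
  (forall i j, 0 < i -> i <= j -> s i <= s j).

(* [ordS] is the cyclic successor; the side condition only discards the loop
   arising for n = 1. *)
Definition cycle_edges (n : nat) : {set {set 'I_n}} :=
  [set [set i; ordS i] | i : 'I_n & i != ordS i].

Lemma cycle_edgesP n :
  [forall e in cycle_edges n, (e \subset [set: 'I_n]) && (#|e| == 2)].
Proof.
apply/forall_inP=> e /imsetP[i]; rewrite inE => ni ->.
by rewrite subsetT cards2 ni.
Qed.

Definition cycle_graph (n : nat) : graph 'I_n := Graph (cycle_edgesP n).

(* Main.v *)
(* For n <= 2 s_2 + 1 the diameter of C_n is at most s_2, so every colour other
   than 1 is used at most once, while colour 1 covers at most half of the
   vertices: at least 1 + ceil(n / 2) colours are needed.  A proper subgraph lies
   on a path with n vertices, on which colour 1 can be put on every other vertex.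
   One colour is saved if n is odd (ceil(n / 2) vertices get colour 1), or if n is
   even and s_2 + 3 <= n (the first and the last of the remaining vertices, at
   distance n - 2, share colour 2).  If n is even and n <= s_2 + 2, only the two
   ends of the path could share a colour i > 1; but then colour 1 is restricted
   to at most n / 2 - 1 vertices, and nothing is gained. *)

Require Import Defs.
From mathcomp Require Import all_boot.
From mathcomp Require Import zify.

(** * Distances through walk lengths *)

Section Distance.

Variables (T : finType) (G : graph T).
Implicit Types u v : T.

Lemma adj_sym u v : adj G u v = adj G v u.
Proof. by rewrite /adj setUC. Qed.

(** Infinite distance needs no case of its own: between components there is no walk, and the
    condition holds vacuously. *)
Lemma gdist_gtP u v k :
  reflect (forall p, path (adj G) u p -> last u p = v -> k < size p)
          (gdist_gt G u v k).
Proof.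
rewrite /gdist_gt /gdist.
destruct (@idP (connect (adj G) u v)) as [uv|nuv]; last first.
  by apply: ReflectT => p pP pv; case: nuv; apply/connectP; exists p.
apply: (iffP idP); case: (ex_minnP (connect_has_walk uv)) => d.
  move=> _ dmin kd q qP qv; apply: leq_trans kd (dmin _ _).
  apply/existsP; exists (in_tuple q).
  by rewrite /= qP qv eqxx.
case/existsP=> p /andP[pP /eqP pv] _ /(_ p pP pv).
by rewrite size_tuple.
Qed.

Lemma gdist_gt_sym u v k : gdist_gt G u v k -> gdist_gt G v u k.
Proof.
move/gdist_gtP=> uvk; apply/gdist_gtP => p pP pu.
have := uvk (rev (belast v p)); rewrite size_rev size_belast; apply.
  by rewrite -pu rev_path (eq_path (e' := adj G)) // => x y; exact: adj_sym.
by case: p {pP} pu => [/= ->|x p _] //=; rewrite rev_cons last_rcons.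
Qed.

Lemma gdist_gt1 u v : u != v -> ~~ adj G u v -> gdist_gt G u v 1.
Proof.
move=> uv nadj; apply/gdist_gtP => -[|x [|y p]] //=.
  by move=> _ eq_uv; rewrite eq_uv eqxx in uv.
by rewrite andbT => ux xv; rewrite -xv ux in nadj.
Qed.

Lemma gdist_gt1_nadj u v : gdist_gt G u v 1 -> ~~ adj G u v.
Proof.
move/gdist_gtP=> uv; apply/negP => uv_adj.
by have := uv [:: v]; rewrite /= uv_adj => /(_ isT erefl).
Qed.

(** Each step of a walk raises [f] by at most 1, and also lowers it by at most 1 since adjacency is
    symmetric. *)
Lemma lipschitz_gdist_gt (f : T -> nat) u v k :
    (forall x y, adj G x y -> f y <= (f x).+1) ->
  k < (f u - f v) + (f v - f u) -> gdist_gt G u v k.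
Proof.
move=> fL kuv; apply/gdist_gtP => p pP pv.
suff: f v <= f u + size p /\ f u <= f v + size p by lia.
elim: p u {kuv} pP pv => [|x p IHp] u /=; first by move=> _ ->; lia.
case/andP=> ux pP pv; have [] := IHp x pP pv.
have := fL _ _ ux; rewrite adj_sym in ux; have := fL _ _ ux; lia.
Qed.

End Distance.

(** * Packing colourings and counting of colours *)

Section PackingColorings.

Variables (T : finType) (G : graph T) (s : nat -> nat).

Lemma chiS_leq m : packing_colorable s G m -> chiS s G <= m.
Proof. by rewrite /chiS; case: ex_minnP => k _; apply. Qed.

Lemma leq_chiS k :
  (forall m, packing_colorable s G m -> k <= m) -> k <= chiS s G.
Proof. by rewrite /chiS => kmin; case: ex_minnP => m /kmin. Qed.

Lemma packing_coloring_gt0 m (c : {ffun T -> 'I_m.+1}) u :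
  packing_coloring s G c -> u \in verts G -> 0 < c u.
Proof. by case/andP=> /forall_inP c0 _; apply: c0. Qed.

Lemma packing_coloring_gt m (c : {ffun T -> 'I_m.+1}) u v :
    packing_coloring s G c -> u \in verts G -> v \in verts G ->
  u != v -> c u = c v -> gdist_gt G u v (s (c u)).
Proof.
case/andP=> _ /forall_inP cP Gu Gv uv cuv.
by have /forall_inP/(_ v Gv) := cP u Gu; rewrite uv cuv eqxx.
Qed.

Lemma packing_colorable_nat m (c : T -> nat) :
    (forall v, 0 < c v <= m) ->
    (forall u v, u != v -> c u = c v -> gdist_gt G u v (s (c u))) ->
  packing_colorable s G m.
Proof.
move=> cm cP; apply/existsP; exists [ffun v => inord (c v)].
have cE v : (inord (c v) : 'I_m.+1) = c v :> nat.
  by rewrite inordK //; have := cm v; lia.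
apply/andP; split; apply/forall_inP => u _.
  by rewrite ffunE cE; case/andP: (cm u).
apply/forall_inP => v _; apply/implyP; rewrite !ffunE => /andP[uv /eqP cuv].
by rewrite cE; apply: cP; rewrite // -cE cuv cE.
Qed.

(** Only [m.-1] colours lie between 2 and [m]; this bounds the vertices outside colour class 1 from
    above. *)
Lemma card_inj_coloring m (c : {ffun T -> 'I_m.+1}) (D : {set T}) :
    {in D, forall v, 1 < c v} -> {in D &, injective c} -> #|D| <= m.-1.
Proof.
move=> D1 cinj; rewrite -(card_in_imset cinj).
have sub : c @: D \subset [set x | 1 < val x].
  by apply/subsetP=> _ /imsetP[v Dv ->]; rewrite inE D1.
apply: leq_trans (subset_leq_card sub) _; case: m {c D1 cinj sub} => [|m].
  by rewrite leqn0 cards_eq0; apply/eqP/setP=> x; rewrite !inE; case: x; case.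
have -> : [set x : 'I_m.+2 | 1 < val x] = ~: [set ord0; lift ord0 ord0].
  apply/setP=> x; rewrite !inE -!val_eqE /= /bump /=; lia.
have := cardsC [set ord0; lift ord0 ord0 : 'I_m.+2].
by rewrite cards2 card_ord add2n => -[->].
Qed.

End PackingColorings.

(** * Adjacency, subgraphs and distances in cycles *)

Section Cycles.

Lemma modn_ordS n (i : 'I_n) : i.+1 %% n = if i.+1 == n then 0 else i.+1.
Proof.
case: eqP => [->|/eqP ne]; first by rewrite modnn.
by rewrite modn_small // ltn_neqAle ne ltn_ord.
Qed.

Lemma ordS_neq n (u : 'I_n) : 1 < n -> u != ordS u.
Proof. by move=> n1; rewrite -val_eqE /= modn_ordS; case: ifP; lia. Qed.

Lemma adj_cycle n (u v : 'I_n) : 1 < n ->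
  adj (cycle_graph n) u v = (v == ordS u) || (u == ordS v).
Proof.
move=> n1; have neS (w : 'I_n) := ordS_neq _ w n1.
apply/imsetP/orP => [[i _ /setP uvi]|[]/eqP->]; last 2 first.
- by exists u; rewrite ?inE.
- by exists v; rewrite ?inE // setUC.
(* Membership of [u] and [v] sends each to [i] or [ordS i]; that of [i] and [ordS i] rules out that
   both go to the same one. *)
have := uvi i; have := uvi (ordS i); have := uvi u; have := uvi v.
rewrite !inE !eqxx !orbT /= => /esym/orP[]/eqP-> /esym/orP[]/eqP->.
- by rewrite !orbb [_ == i]eq_sym (negPf (neS i)).
- by rewrite !eqxx; auto.
- by rewrite !eqxx; auto.
- by rewrite !orbb (negPf (neS i)).
Qed.

(** A missing vertex [i] takes the edge [{i, ordS i}] with it, so in every case some edge is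
    missing. *)
Lemma proper_subgraph_cycle n (H : graph 'I_n) : 1 < n ->
    proper_subgraph H (cycle_graph n) ->
  exists i, forall u v, adj H u v ->
    (v == ordS u) && (u != i) || (u == ordS v) && (v != i).
Proof.
move=> n1 /andP[/andP[sV sE] HG].
suff [i niH] : exists i, [set i; ordS i] \notin edges H.
  exists i => u v uvH; have := subsetP sE _ uvH.
  rewrite -[_ \in _]/(adj (cycle_graph n) u v) adj_cycle //.
  case/orP=> /eqP e; rewrite e eqxx /=; apply/orP; [left | right];
    apply: contraNN niH => /eqP <-; rewrite -e //.
  by rewrite setUC.
case/orP: HG => [nV|nE].
  have /subsetPn[i _ iV] : ~~ ([set: 'I_n] \subset verts H).
    by apply: contra nV => sH; rewrite eqEsubset sV.
  exists i; apply: contra iV => /(forall_inP (edgesP H))/andP[/subsetP sub _].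
  by apply: sub; rewrite !inE eqxx.
have /subsetPn[e /imsetP[i _ ->] niH] : ~~ (cycle_edges n \subset edges H).
  by apply: contra nE => sH; rewrite eqEsubset sE.
by exists i.
Qed.

(** Only the edges that do not wrap around are assumed, so both the cycle and the path qualify. *)
Lemma increasing_path n (G : graph 'I_n) :
    (forall i : 'I_n, i.+1 < n -> adj G i (ordS i)) ->
  forall (u v : 'I_n), u <= v ->
  exists2 p, path (adj G) u p && (last u p == v) & size p = v - u.
Proof.
move=> adjS u v; move: {2}(v - u) (erefl (v - u)) => d.
elim: d u => [|d IHd] u uvd uv.
  by exists [::]; rewrite //= -val_eqE /=; lia.
have Su : u.+1 < n by have := ltn_ord v; lia.
have SuE : ordS u = u.+1 :> nat by rewrite /= modn_ordS; case: eqP => //; lia.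
have [||p /andP[pP pv] sp] := IHd (ordS u); rewrite ?SuE; try lia.
exists (ordS u :: p); first by rewrite /= adjS // pP.
by rewrite /= sp SuE; lia.
Qed.

Lemma gdist_gt_up n (G : graph 'I_n) (u v : 'I_n) k :
    (forall i : 'I_n, i.+1 < n -> adj G i (ordS i)) -> u <= v ->
  gdist_gt G u v k -> k < v - u.
Proof.
move=> adjS uv /gdist_gtP kuv.
have [p /andP[pP /eqP pv] <-] := increasing_path _ _ adjS _ _ uv.
exact: kuv.
Qed.

Lemma cycle_gdist_gt n (u v : 'I_n) k : 2 < n -> u <= v ->
  gdist_gt (cycle_graph n) u v k -> k < v - u /\ k < n - (v - u).
Proof.
move=> n2 uv kuv.
have adjS (i : 'I_n) : i.+1 < n -> adj (cycle_graph n) i (ordS i).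
  by rewrite adj_cycle ?eqxx //; lia.
split; first exact: gdist_gt_up kuv.
have n0 : 0 < n by lia.
have nn : n.-1 < n by lia.
have v_max : v <= Ordinal nn by rewrite /=; have := ltn_ord v; lia.
have [p /andP[pP /eqP pv] sp] := increasing_path _ _ adjS _ _ v_max.
have [q /andP[qP /eqP qv] sq] := increasing_path _ _ adjS (Ordinal n0) u (leq0n u).
have S0 : ordS (Ordinal nn) = Ordinal n0.
  by apply: val_inj; rewrite /= prednK // modnn.
(* The other arc: from [v] up to [n.-1], across to 0, then up to [u]. *)
move/gdist_gt_sym/gdist_gtP: kuv => /(_ (p ++ Ordinal n0 :: q)).
rewrite cat_path last_cat pP pv /= -{1}S0 adj_cycle ?eqxx ?qP; last by lia.
move=> /(_ isT qv).
by rewrite size_cat /= sp sq /=; have := ltn_ord v; lia.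
Qed.

End Cycles.

(** * The spanning path left by deleting the wrap-around edge *)

Section Path.

Variable n' : nat.
Notation n := n'.+1.

Definition path_edges := cycle_edges n :\ [set ord_max; ord0].

Lemma path_edgesP :
  [forall e in path_edges, (e \subset [set: 'I_n]) && (#|e| == 2)].
Proof.
apply/forall_inP=> e /setD1P[_]; exact: (forall_inP (cycle_edgesP n)).
Qed.

Definition path_graph : graph 'I_n := Graph path_edgesP.

Lemma proper_path_graph : 2 < n -> proper_subgraph path_graph (cycle_graph n).
Proof.
move=> n2; rewrite /proper_subgraph /subgraph subxx subsetDl /=.
apply/orP; right; apply/negP => /eqP/setP/(_ [set ord_max; ord0]).
rewrite !inE eqxx -[RHS]/(adj (cycle_graph n) ord_max ord0) adj_cycle; last by lia.
by rewrite -!val_eqE /= modnn.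
Qed.

Lemma adj_path_graph (i : 'I_n) : 2 < n -> i.+1 < n -> adj path_graph i (ordS i).
Proof.
move=> n2 iS; rewrite /adj !inE -[X in _ && X]/(adj (cycle_graph n) i (ordS i)).
rewrite adj_cycle ?eqxx ?andbT; last by lia.
apply/negP => /eqP/setP e; have := e ord0; have := e ord_max.
by rewrite !inE !eqxx -!val_eqE /= modn_small //; lia.
Qed.

End Path.

(** * Bounds on the chromatic numbers *)

Section ChromaticNumbers.

Variable s : nat -> nat.
Hypotheses (hs : packing_sequence s) (hs1 : s 1 = 1).

(* Cut the cycle at the missing edge [{i, ordS i}]; [f] is the position along
   the resulting path.  For even [n], the reduction modulo [n.-1./2] gives both
   positions 1 and [n.-1] colour 2. *)
Lemma chiS_proper_subgraph n (H : graph 'I_n) : 2 < n ->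
    odd n || (s 2 + 3 <= n) -> proper_subgraph H (cycle_graph n) ->
  chiS s H <= (n.-1./2).+1.
Proof.
move=> n2 hn /proper_subgraph_cycle[|i adjH]; first by lia.
pose f (v : 'I_n) := if v <= i then v + (n.-1 - i) else v - i.+1.
have fn v : f v < n.
  by rewrite /f; have := ltn_ord v; have := ltn_ord i; case: ifP; lia.
have finj u v : u != v -> f u != f v.
  rewrite -val_eqE /f /=; have := ltn_ord u; have := ltn_ord v.
  by have := ltn_ord i; do 2 case: ifP; lia.
have fL x y : adj H x y -> f y <= (f x).+1.
  have ne (w : 'I_n) : w != i -> f (ordS w) = (f w).+1.
    rewrite -val_eqE /f /= modn_ordS.
    by have := ltn_ord i; have := ltn_ord w; do 3?[case: ifP]; lia.
  by case/adjH/orP=> /andP[/eqP-> /ne ->]; lia.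
pose k := n.-1./2; have k0 : 0 < k by rewrite /k; lia.
apply/chiS_leq/(packing_colorable_nat _ _ _ _
  (fun v : 'I_n => if odd (f v) then (f v)./2 %% k + 2 else 1)).
  by move=> v; case: ifP => //; have := ltn_pmod (f v)./2 k0; lia.
move=> u v uv cuv; apply: (lipschitz_gdist_gt _ _ f) => //.
move: cuv (finj _ _ uv) (fn u) (fn v); rewrite -/k.
case: ifP => ou; case: ifP => ov; [|lia|lia|by rewrite hs1; lia].
have modk w : odd w -> w < n -> w./2 %% k = if w./2 == k then 0 else w./2.
  move=> ow wn; case: eqP => [->|?]; first by rewrite modnn.
  by rewrite modn_small // /k in k0 *; lia.
move=> cuv fuv fu fv; move: cuv; rewrite !modk //.
(* Only positions 1 and [n.-1] can share a colour above 1, and only for even [n], where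
   [s 2 + 3 <= n] puts [n - 2] above [s 2]. *)
case: ifP => uk; case: ifP => vk cuv; rewrite ?add0n /k in uk vk cuv *; try lia.
rewrite cuv; lia.
Qed.

Lemma seq_ge2 i : 1 < i -> s 2 <= s i.
Proof. by move=> i1; apply: hs.2. Qed.

(** As [s 1 = 1], class 1 is independent; this will separate the class from its cyclic shift. *)
Lemma color1_ordS n (G : graph 'I_n) m (c : {ffun 'I_n -> 'I_m.+1}) u :
    1 < n -> verts G = setT -> packing_coloring s G c -> adj G u (ordS u) ->
  c u <= 1 -> 1 < c (ordS u).
Proof.
move=> n1 GT cP aS cu; rewrite ltnNge; apply/negP => cS.
have eq1 v : c v <= 1 -> c v = 1 :> nat.
  have := packing_coloring_gt0 _ _ _ _ _ v cP; rewrite GT inE => /(_ isT).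
  by case: (nat_of_ord (c v)) => [|[]].
have := packing_coloring_gt _ _ _ _ _ u (ordS u) cP.
rewrite GT !inE (eq1 _ cu) hs1 => /(_ isT isT (ordS_neq _ _ n1)).
have -> : c u = c (ordS u).
  by apply: val_inj; exact: etrans (eq1 _ cu) (esym (eq1 _ cS)).
by move/(_ erefl)/gdist_gt1_nadj; rewrite aS.
Qed.

Lemma chiS_cycle_geq n : 2 < n -> n <= 2 * s 2 + 1 ->
  (uphalf n).+1 <= chiS s (cycle_graph n).
Proof.
move=> n2 ns; apply: leq_chiS => m /existsP[c cP].
have adjS (i : 'I_n) : adj (cycle_graph n) i (ordS i).
  by rewrite adj_cycle ?eqxx //; lia.
(* Colour 0 is never used, so [A] is the colour class 1. *)
pose A := [set v | c v <= 1].
have cardA : 2 * #|A| <= n.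
  have := cardsUI A (@ordS n @: A); rewrite (card_imset _ (@ordS_inj n)).
  have -> : A :&: (@ordS n @: A) = set0.
    apply/setP=> w; rewrite !inE; apply/negP => /andP[cw /imsetP[v]].
    rewrite inE => cv wE; rewrite wE in cw.
    have := color1_ordS _ (cycle_graph n) _ _ v (ltnW n2) erefl cP (adjS v) cv.
    by rewrite ltnNge cw.
  rewrite cards0 => e; have := max_card (A :|: (@ordS n @: A)).
  by rewrite card_ord mul2n -addnn -e addn0.
have c0 v : 0 < c v by apply: packing_coloring_gt0 cP _; rewrite inE.
have : #|~: A| <= m.-1.
  apply: (card_inj_coloring _ _ c) => [v|u v].
    by rewrite !inE -ltnNge.
  wlog uv : u v / u <= v => [wl|].
    case/orP: (leq_total u v) => uv uA vA cuv; first exact: wl.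
    by apply/esym/wl.
  rewrite !inE -!ltnNge => cu vA cuv; apply/eqP; apply: contraT => neq_uv.
  have := packing_coloring_gt _ _ _ _ _ u v cP; rewrite !inE.
  move=> /(_ isT isT neq_uv cuv) /cycle_gdist_gt[] //.
  (* The two arcs add up to [n], so both exceeding [k >= s 2] would give [n >= 2 * s 2 + 2]. *)
  by move: (seq_ge2 _ cu) (uv); move: (s (c u)) => k; lia.
have m0 : 0 < m.
  have := c0 (Ordinal (ltnW (ltnW n2))).
  by move/leq_trans; apply; rewrite -ltnS.
have := cardsC A; rewrite card_ord.
move: #|A| #|~: A| cardA => a b; lia.
Qed.

(** Even positions get colour 1, odd ones distinct colours; since [n] is even, [n.-1] and 0 do not
    both get colour 1. *)
Lemma chiS_even_cycle_leq n : 2 < n -> ~~ odd n ->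
  chiS s (cycle_graph n) <= (n./2).+1.
Proof.
move=> n2 on; apply/chiS_leq/(packing_colorable_nat _ _ _ _
  (fun v : 'I_n => if odd v then v./2 + 2 else 1)).
  by move=> v; have := ltn_ord v; case: ifP; lia.
move=> u v uv; have := uv; rewrite -val_eqE /=.
case: ifP => ou; case: ifP => ov; try lia.
move=> _ _; rewrite hs1; apply: gdist_gt1 => //; rewrite adj_cycle; last by lia.
by rewrite -!val_eqE /= !modn_ordS; do 2 case: ifP; lia.
Qed.

(** With the wrap-around edge gone, class 1 and its shift may meet, but only in [ord0]. The count
    splits on whether the two ends share a colour above 1. *)
Lemma chiS_path_geq n' : 2 < n'.+1 -> ~~ odd n'.+1 -> n'.+1 <= s 2 + 2 ->
  (n'.+1)./2.+1 <= chiS s (path_graph n').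
Proof.
move=> n2 on ns; apply: leq_chiS => m /existsP[c cP].
pose A := [set v | c v <= 1].
have c0 v : 0 < c v by apply: packing_coloring_gt0 cP _; rewrite inE.
have ends (u v : 'I_n'.+1) : u < v -> c u = c v -> 1 < c u -> u = ord0 /\ v = ord_max.
  move=> uv cuv cu; have := packing_coloring_gt _ _ _ _ _ u v cP.
  rewrite !inE -val_eqE /= => /(_ isT isT).
  rewrite neq_ltn uv => /(_ isT cuv) /(gdist_gt_up _ _ _ _ _ _ (ltnW uv)) h.
  have {}h := h (fun i => adj_path_graph n' i n2).
  have := leq_ltn_trans (seq_ge2 _ cu) h; have := ltn_ord v.
  by split; apply: val_inj => /=; lia.
have AI : A :&: (@ordS n'.+1 @: A) \subset [set ord0].
  apply/subsetP=> w; rewrite !inE => /andP[cw /imsetP[v]].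
  rewrite inE => cv wE; rewrite wE in cw *.
  have [vS|vS] := boolP (v.+1 < n'.+1); last first.
    by rewrite -val_eqE /= modn_ordS; have := ltn_ord v; case: ifP; lia.
  have vSP := adj_path_graph n' v n2 vS.
  have := color1_ordS _ (path_graph n') _ _ v (ltnW n2) erefl cP vSP cv.
  by rewrite ltnNge cw.
have := cardsUI A (@ordS n'.+1 @: A); rewrite (card_imset _ (@ordS_inj n'.+1)).
have := cardsC A; rewrite card_ord.
have m0 : 0 < m by have /leq_trans -> := c0 ord0; rewrite // -ltnS.
(* If they do, [A] and its shift are disjoint and both miss [ord0], so [2 * #|A| <= n']; as [n'] is
   odd, this loss in class 1 makes up for the repeated colour. *)
case: (boolP ((c ord0 == c ord_max) && (1 < c ord0))) => [/andP[/eqP ce c1]|nce].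
  have A0 : ord0 \notin A by rewrite inE -ltnNge.
  have S0 : ord0 \notin @ordS n'.+1 @: A.
    apply/imsetP=> -[v]; rewrite inE => cv /(congr1 val) /=.
    rewrite modn_ordS; case: eqP => // vn _.
    have : v = ord_max by apply: val_inj => /=; lia.
    by move=> vE; rewrite vE -ce leqNgt c1 in cv.
  have -> : A :&: (@ordS n'.+1 @: A) = set0.
    apply/eqP; rewrite -subset0; apply/subsetP => w wAI.
    have := subsetP AI _ wAI; rewrite inE => /eqP w0.
    by move: wAI; rewrite w0 inE (negPf A0).
  rewrite cards0.
  have : #|A :|: (@ordS n'.+1 @: A)| <= n'.
    have : A :|: (@ordS n'.+1 @: A) \subset [set~ ord0].
      apply/subsetP=> w; rewrite !in_setU in_setC1.
      by apply: contraTneq => ->; rewrite negb_or A0.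
    by move/subset_leq_card; rewrite cardsC1 card_ord.
  have : #|~: A :\ ord0| <= m.-1.
    apply: (card_inj_coloring _ _ c) => [v|u v].
      by rewrite !inE -ltnNge => /andP[].
    rewrite !inE -!ltnNge => /andP[u0 cu] /andP[v0 vA] cuv.
    case: (ltngtP u v) => [uv|vu|/val_inj //].
      by have [e _] := ends _ _ uv cuv cu; rewrite e eqxx in u0.
    rewrite cuv in cu.
    by have [e _] := ends _ _ vu (esym cuv) cu; rewrite e eqxx in v0.
  have := cardsD1 ord0 (~: A); rewrite in_setC A0 add1n.
  by move: #|A| #|~: A| #|_ :\ _| #|_ :|: _| => *; lia.
(* Otherwise no colour above 1 repeats, and [2 * #|A| <= n'.+2] with [n'.+1] even still gives at
   most half of the vertices. *)
have : #|~: A| <= m.-1.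
  apply: (card_inj_coloring _ _ c) => [v|u v].
    by rewrite !inE -ltnNge.
  rewrite !inE -!ltnNge => cu vA cuv.
  case: (ltngtP u v) => [uv|vu|/val_inj //].
    have [e e'] := ends _ _ uv cuv cu.
    by move: nce; rewrite -e -e' cuv eqxx -cuv cu.
  rewrite cuv in cu; have [e e'] := ends _ _ vu (esym cuv) cu.
  by move: nce; rewrite -e -e' cuv eqxx cu.
have := subset_leq_card AI; rewrite cards1.
have := max_card (A :|: (@ordS n'.+1 @: A)); rewrite card_ord.
by move: #|A| #|~: A| #|_ :|: _| #|_ :&: _| => *; lia.
Qed.

End ChromaticNumbers.

Theorem theorem4p2 (s : nat -> nat) (n : nat)
    (hs : packing_sequence s) (hs1 : s 1 = 1) (hn : 3 <= n) :
  (n <= s 2 + 2 -> (chiS_critical s (cycle_graph n) <-> odd n)) /\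
  (s 2 + 3 <= n <= 2 * s 2 + 1 -> chiS_critical s (cycle_graph n)).
Proof.
(* Yields [s 2 + 2 <= 2 * s 2 + 1], so that [crit] also covers odd [n] in the first range. *)
have s2 : 0 < s 2 by apply: hs.1.
have crit : n <= 2 * s 2 + 1 -> odd n || (s 2 + 3 <= n) ->
    chiS_critical s (cycle_graph n).
  move=> n_le on H propH _.
  have := chiS_proper_subgraph s hs1 n H hn on propH.
  have := chiS_cycle_geq s hs hs1 n hn n_le.
  by lia.
split=> [n_le|/andP[n_ge n_le]]; last by apply: crit; rewrite ?n_ge ?orbT.
split=> [critC|on]; last by apply: crit; rewrite ?on //; lia.
(* For even [n] the spanning path already needs the [n./2.+1] colours that suffice for the cycle. *)
apply: contraT => on; case: n hn n_le on critC {crit} => // n' hn n_le on critC.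
have := critC _ (proper_path_graph n' hn).
have -> : verts (path_graph n') != set0 by apply/set0Pn; exists ord0; rewrite inE.
have := chiS_path_geq s hs hs1 n' hn on n_le.
have := chiS_even_cycle_leq s hs1 n'.+1 hn on.
by move=> a b /(_ isT); lia.
Qed.
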